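(* Let $n\ge3$, let $\mathcal B_1$ be an $\mathrm{AI}$-crystal and $\mathcal B_2$ a $\mathfrak{gl}_n$-crystal. Then $\mathcal B_1\otimes\mathcal B_2:=\mathcal B_1\times\mathcal B_2$ (with $(b_1,b_2)$ written $b_1\otimes b_2$) is an $\mathrm{AI}$-crystal with the following structure maps, for $i\in\{1,\dots,n-1\}$: $$\deg_i(b_1\otimes b_2)=\begin{cases}\deg_i(b_1)-\varphi_i(b_2)+\varepsilon_i(b_2)&\text{if }\deg_i(b_1)>\varphi_i(b_2),\\ \varepsilon_i(b_2)&\text{if }\varphi_i(b_2)-\deg_i(b_1)\text{ is a nonnegative even integer},\\ \varepsilon_i(b_2)+1&\text{if }\varphi_i(b_2)-\deg_i(b_1)\text{ is a nonnegative odd integer},\end{cases}$$ $$\widetilde B_i(b_1\otimes b_2)=\begin{cases}\widetilde B_ib_1\otimes b_2&\text{if }\deg_i(b_1)>\varphi_i(b_2),\\ b_1\otimes\widetilde E_ib_2&\text{if }\varphi_i(b_2)-\deg_i(b_1)\text{ is a nonnegative even integer},\\ b_1\otimes\widetilde F_ib_2&\text{if }\varphi_i(b_2)-\deg_i(b_1)\text{ is a nonnegative odd integer}.\end{cases}$$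
   Context: An $\mathrm{AI}$-crystal (more precisely $\mathrm{AI}_{n-1}$-crystal) is a set $\mathcal B$ with maps $\widetilde B_i:\mathcal B\to\mathcal B\sqcup\{0\}$ and $\deg_i:\mathcal B\to\mathbb Z_{\ge0}$, $i\in\{1,\dots,n-1\}$ ($0$ a formal symbol), such that for all $b\in\mathcal B$ and $i,j$ with $\widetilde B_ib\ne0$: (1) $\deg_i(\widetilde B_ib)=\deg_i(b)$ and $\widetilde B_i^2b=b$; (2) if $|i-j|=1$ then $\deg_j(\widetilde B_ib)-\deg_j(b)\in\{1,-1\}$; (3) if $|i-j|>1$ then $\deg_j(\widetilde B_ib)=\deg_j(b)$. A $\mathfrak{gl}_n$-crystal here means a Stembridge crystal of type $\mathfrak{gl}_n$: a set $\mathcal B$ with maps $\widetilde E_i,\widetilde F_i:\mathcal B\to\mathcal B\sqcup\{0\}$, $\varepsilon_i,\varphi_i:\mathcal B\to\mathbb Z_{\ge0}$ ($1\le i\le n-1$) and $\mathrm{wt}:\mathcal B\to\mathbb Z^n$ satisfying the usual crystal axioms and Stembridge's local axioms; in particular, with $\widetilde E_i0=\widetilde F_i0=0$: $\widetilde F_ib=b'$ iff $b=\widetilde E_ib'$; $\varepsilon_i(b)=\max\{k:\widetilde E_i^kb\ne0\}$, $\varphi_i(b)=\max\{k:\widetilde F_i^kb\neq0\}$; if $|i-j|>1$ and $\widetilde E_ib\ne0$ then $\varepsilon_j(\widetilde E_ib)=\varepsilon_j(b)$, $\varphi_j(\widetilde E_ib)=\varphi_j(b)$ and $\widetilde E_j\widetilde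 E_ib=\widetilde E_i\widetilde E_jb$; if $|i-j|=1$ and $\widetilde E_ib\ne0$ then either $\varepsilon_j(\widetilde E_ib)=\varepsilon_j(b)$ and $\varphi_j(\widetilde E_ib)=\varphi_j(b)-1$, or $\varepsilon_j(\widetilde E_ib)=\varepsilon_j(b)+1$ and $\varphi_j(\widetilde E_ib)=\varphi_j(b)$. Convention: $0\otimes b_2=b_1\otimes0=0$. *)

(* Defs.v *)
From mathcomp Require Import all_boot all_order all_algebra.
Set Implicit Arguments.
Unset Strict Implicit.
Unset Printing Implicit Defensive.
Import GRing.Theory.
Local Open Scope ring_scope.

(* The index set {1, ..., n-1} is represented by 'I_n.-1, the ordinal i       *)
(* standing for the index i + 1.  The formal symbol 0 is None, so a map       *)
(* B -> B \sqcup {0} is a function B -> option B, extended by 0 |-> 0 through *)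
(* obind.                                                                     *)

Record is_AI_crystal (n : nat) (B : Type)
    (Bt : 'I_n.-1 -> B -> option B) (deg : 'I_n.-1 -> B -> nat) : Prop := {
  AI_deg_same : forall i b b', Bt i b = Some b' -> deg i b' = deg i b;
  AI_invol : forall i b b', Bt i b = Some b' -> obind (Bt i) (Bt i b) = Some b;
  AI_deg_adj : forall (i j : 'I_n.-1) b b', Bt i b = Some b' -> `|i - j|%N = 1%N ->
    (deg j b')%:Z - (deg j b)%:Z = 1 \/ (deg j b')%:Z - (deg j b)%:Z = -1;
  AI_deg_far : forall (i j : 'I_n.-1) b b', Bt i b = Some b' -> (1 < `|i - j|)%N ->
    deg j b' = deg j b
}.

Definition is_max (P : nat -> Prop) (m : nat) : Prop :=
  P m /\ forall k, P k -> (k <= m)%N.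

(* alpha_i = e_i - e_{i+1} in Z^n.                                            *)
Definition simple_root (n : nat) (i : 'I_n.-1) : 'rV[int]_n :=
  \row_(k < n) ((k == i :> nat)%:R - (k == i.+1 :> nat)%:R).

(* <w, alpha_i^vee>, the coroot alpha_i^vee being identified with alpha_i     *)
(* through the standard bilinear form on Z^n; this is w_i - w_{i+1}.          *)
Definition coroot_pairing (n : nat) (w : 'rV[int]_n) (i : 'I_n.-1) : int :=
  \sum_(k < n) w 0 k * simple_root i 0 k.

(* Stembridge crystals of type gl_n: the seminormal crystal axioms (gl_EF to  *)
(* gl_wt_pairing) followed by Stembridge's local axioms in the form of Bump   *)
(* and Schilling, Crystal Bases (2017), Section 4.2.  Their axiom S1 is the   *)
(* content of gl_far and gl_adj; the conditions eps > 0 and phi > 0 of S2,    *)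
(* S3 and of the dual axioms S2', S3' are expressed by E_i b and E_j b (resp. *)
(* F_i b and F_j b) being nonzero.                                            *)
Record is_gl_crystal (n : nat) (B : Type)
    (E F : 'I_n.-1 -> B -> option B) (eps phi : 'I_n.-1 -> B -> nat)
    (wt : B -> 'rV[int]_n) : Prop := {
  gl_EF : forall i b b', F i b = Some b' <-> Some b = E i b';
  gl_eps : forall i b,
    is_max (fun k => iter k (obind (E i)) (Some b) <> None) (eps i b);
  gl_phi : forall i b,
    is_max (fun k => iter k (obind (F i)) (Some b) <> None) (phi i b);
  gl_wt_E : forall i b b', E i b = Some b' -> wt b' = wt b + simple_root i;
  gl_wt_pairing : forall i b,
    coroot_pairing (wt b) i = (phi i b)%:Z - (eps i b)%:Z;
  gl_far : forall (i j : 'I_n.-1) b b', (1 < `|i - j|)%N -> E i b = Some b' ->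
    eps j b' = eps j b /\ phi j b' = phi j b;
  gl_far_comm : forall (i j : 'I_n.-1) b b', (1 < `|i - j|)%N -> E i b = Some b' ->
    obind (E j) (E i b) = obind (E i) (E j b);
  gl_adj : forall (i j : 'I_n.-1) b b', `|i - j|%N = 1%N -> E i b = Some b' ->
    (eps j b' = eps j b /\ (phi j b')%:Z = (phi j b)%:Z - 1) \/
    (eps j b' = (eps j b + 1)%N /\ phi j b' = phi j b);
  gl_S2 : forall (i j : 'I_n.-1) b x y, i != j -> E i b = Some x -> E j b = Some y ->
    eps j x = eps j b ->
    E i y = E j x /\ phi i y = phi i b;
  gl_S2' : forall (i j : 'I_n.-1) b x y, i != j -> F i b = Some x -> F j b = Some y ->
    phi j x = phi j b ->
    F i y = F j x /\ eps i y = eps i b;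
  gl_S3 : forall (i j : 'I_n.-1) b x y, i != j -> E i b = Some x -> E j b = Some y ->
    eps j x = (eps j b + 1)%N -> eps i y = (eps i b + 1)%N ->
    exists u v w,
      [/\ obind (E j) (E j x) = Some u, obind (E i) (E i y) = Some v,
          E i u = Some w /\ E j v = Some w,
          phi i y = phi i u & phi j x = phi j v];
  gl_S3' : forall (i j : 'I_n.-1) b x y, i != j -> F i b = Some x -> F j b = Some y ->
    phi j x = (phi j b + 1)%N -> phi i y = (phi i b + 1)%N ->
    exists u v w,
      [/\ obind (F j) (F j x) = Some u, obind (F i) (F i y) = Some v,
          F i u = Some w /\ F j v = Some w,
          eps i y = eps i u & eps j x = eps j v]
}.

Definition tens_l (B1 B2 : Type) (o : option B1) (b2 : B2) : option (B1 * B2) :=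
  omap (fun b1 => (b1, b2)) o.

Definition tens_r (B1 B2 : Type) (b1 : B1) (o : option B2) : option (B1 * B2) :=
  omap (fun b2 => (b1, b2)) o.

(* Each natural number subtraction below is evaluated only where it is the    *)
(* subtraction of Z.                                                          *)
Definition tens_deg (n : nat) (B1 B2 : Type) (deg : 'I_n.-1 -> B1 -> nat)
    (eps phi : 'I_n.-1 -> B2 -> nat) (i : 'I_n.-1) (b : B1 * B2) : nat :=
  let: (b1, b2) := b in
  if (deg i b1 > phi i b2)%N then (deg i b1 - phi i b2 + eps i b2)%N
  else if ~~ odd (phi i b2 - deg i b1) then eps i b2
  else (eps i b2 + 1)%N.

Definition tens_Bt (n : nat) (B1 B2 : Type)
    (Bt : 'I_n.-1 -> B1 -> option B1) (deg : 'I_n.-1 -> B1 -> nat)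
    (E F : 'I_n.-1 -> B2 -> option B2) (phi : 'I_n.-1 -> B2 -> nat)
    (i : 'I_n.-1) (b : B1 * B2) : option (B1 * B2) :=
  let: (b1, b2) := b in
  if (deg i b1 > phi i b2)%N then tens_l (Bt i b1) b2
  else if ~~ odd (phi i b2 - deg i b1) then tens_r b1 (E i b2)
  else tens_r b1 (F i b2).

(* Main.v *)
Require Import Defs.
From mathcomp Require Import all_boot all_order all_algebra.
From mathcomp Require Import zify.

Set Implicit Arguments.
Unset Strict Implicit.
Unset Printing Implicit Defensive.

(* Up to the shift by eps_j(b2), deg_j(b1 (x) b2) depends only on the         *)
(* difference deg_j(b1) - phi_j(b2): it has slope 1 where this is positive    *)
(* and alternates between 0 and 1 elsewhere.  So changing deg_j(b1),          *)
(* phi_j(b2) or eps_j(b2) by one changes deg_j(b1 (x) b2) by exactly one.  On *)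
(* b1 (x) b2 with deg_i(b1) <= phi_i(b2), the operators E_i and F_i flip the  *)
(* parity of phi_i(b2) - deg_i(b1), so they alternate and undo each other.    *)

(** Each operator on the tensor product moves one factor, so every axiom reduces to how that move
    changes [deg], [eps] and [phi]. An [E i] step trades one unit of [eps i] for one of [phi i], and
    the extra 1 in the odd case of [tens_deg] makes up for the loss. For adjacent indices exactly
    one of the three numbers changes, by one; for distant ones none does. *)

Lemma is_max_iter_step (B : Type) (f : B -> option B) (b b' : B) (m m' : nat) :
  f b = Some b' ->
  is_max (fun k => iter k (obind f) (Some b) <> None) m ->
  is_max (fun k => iter k (obind f) (Some b') <> None) m' -> m = m'.+1.
Proof.
move=> fb [Pm maxm] [Pm' maxm'].
have step k : iter k.+1 (obind f) (Some b) = iter k (obind f) (Some b').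
  by rewrite iterSr /= fb.
apply/eqP; rewrite eqn_leq maxm ?step // andbT.
by case: m Pm {maxm} => // k; rewrite step => /maxm'.
Qed.

Section GlCrystal.

Variables (n : nat) (B : Type) (E F : 'I_n.-1 -> B -> option B).
Variables (eps phi : 'I_n.-1 -> B -> nat) (wt : B -> 'rV[int]_n).
Hypothesis hB : is_gl_crystal E F eps phi wt.

Lemma gl_F_E i b b' : F i b = Some b' -> E i b' = Some b.
Proof. by move=> Fb; apply/esym/(gl_EF hB). Qed.

Lemma gl_E_F i b b' : E i b = Some b' -> F i b' = Some b.
Proof. by move=> Eb; apply/(gl_EF hB). Qed.

Lemma gl_E_eps i b b' : E i b = Some b' -> eps i b = (eps i b').+1.
Proof.
by move=> Eb; apply: (is_max_iter_step Eb); apply: (gl_eps hB).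
Qed.

Lemma gl_E_phi i b b' : E i b = Some b' -> phi i b' = (phi i b).+1.
Proof.
by move=> Eb; apply: (is_max_iter_step (gl_E_F Eb)); apply: (gl_phi hB).
Qed.

End GlCrystal.

Section TensorProduct.

Variables (n : nat) (B1 B2 : Type).
Variables (Bt : 'I_n.-1 -> B1 -> option B1) (deg : 'I_n.-1 -> B1 -> nat).
Variables (E F : 'I_n.-1 -> B2 -> option B2) (eps phi : 'I_n.-1 -> B2 -> nat).
Variable wt : B2 -> 'rV[int]_n.
Hypothesis hB2 : is_gl_crystal E F eps phi wt.

(** The [F] case is recorded as an [E] arrow ending at [b2], since [gl_far] and [gl_adj] speak of
    [E] only. *)
Variant tens_Bt_spec i b1 b2 : B1 * B2 -> Prop :=
| TensBtL b1' of (phi i b2 < deg i b1)%N & Bt i b1 = Some b1' :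
    tens_Bt_spec i b1 b2 (b1', b2)
| TensBtE b2' of (deg i b1 <= phi i b2)%N & ~~ odd (phi i b2 - deg i b1)
    & E i b2 = Some b2' : tens_Bt_spec i b1 b2 (b1, b2')
| TensBtF b2' of (deg i b1 <= phi i b2)%N & odd (phi i b2 - deg i b1)
    & E i b2' = Some b2 : tens_Bt_spec i b1 b2 (b1, b2').

Lemma tens_BtP i b1 b2 b' :
  tens_Bt Bt deg E F phi i (b1, b2) = Some b' -> tens_Bt_spec i b1 b2 b'.
Proof.
rewrite /tens_Bt /tens_l /tens_r; case: ltnP => [lt | le].
  by case Eb: (Bt i b1) => [b1'|] //= [<-]; apply: TensBtL.
case: ifP => [ev | /negbFE od].
  by case Eb: (E i b2) => [b2'|] //= [<-]; apply: TensBtE.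
by case Eb: (F i b2) => [b2'|] //= [<-]; apply: TensBtF => //; apply: (gl_F_E hB2).
Qed.

Hypothesis hB1 : is_AI_crystal Bt deg.

Lemma tens_AI_crystal :
  is_AI_crystal (tens_Bt Bt deg E F phi) (tens_deg deg eps phi).
Proof.
split.
- move=> i [b1 b2] b' /tens_BtP[b1' lt Eb|b2' le ev Eb|b2' le od Eb] /=.
  + by rewrite (AI_deg_same hB1 Eb).
  + by have := gl_E_eps hB2 Eb; have := gl_E_phi hB2 Eb; do 4?case: ifP; lia.
  + by have := gl_E_eps hB2 Eb; have := gl_E_phi hB2 Eb; do 4?case: ifP; lia.
- move=> i [b1 b2] b' Bb; rewrite Bb.
  case: (tens_BtP Bb) => [b1' lt Eb|b2' le ev Eb|b2' le od Eb] /=.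
  + by rewrite (AI_deg_same hB1 Eb) lt; have := AI_invol hB1 Eb; rewrite Eb /= => ->.
  (* [phi] has grown by one, so the difference is now odd and the [F] branch undoes the step. *)
  + have phib := gl_E_phi hB2 Eb; rewrite ifF ?ifF; [|lia..].
    by rewrite (gl_E_F hB2 Eb).
  (* An odd difference is at least 1, so it stays nonnegative when [F] lowers [phi], and the [E]
     branch applies. *)
  + have phib := gl_E_phi hB2 Eb; rewrite ifF ?ifT; [|lia..].
    by rewrite Eb.
- move=> i j [b1 b2] b' /tens_BtP[b1' lt Eb|b2' le ev Eb|b2' le od Eb] ij /=.
  + by have := AI_deg_adj hB1 Eb ij; do 4?case: ifP; lia.
  + by have := gl_adj hB2 ij Eb; do 4?case: ifP; lia.
  (* The arrow is reversed here, which only swaps the signs 1 and -1. *)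
  + by have := gl_adj hB2 ij Eb; do 4?case: ifP; lia.
- move=> i j [b1 b2] b' /tens_BtP[b1' lt Eb|b2' le ev Eb|b2' le od Eb] ij /=.
  + by rewrite (AI_deg_far hB1 Eb ij).
  + by have [-> ->] := gl_far hB2 ij Eb.
  + by have [-> ->] := gl_far hB2 ij Eb.
Qed.

End TensorProduct.

Theorem proposition2p3p6 (n : nat) (hn : (3 <= n)%N) (B1 B2 : Type)
  (Bt : 'I_n.-1 -> B1 -> option B1) (deg : 'I_n.-1 -> B1 -> nat)
  (E F : 'I_n.-1 -> B2 -> option B2) (eps phi : 'I_n.-1 -> B2 -> nat)
  (wt : B2 -> 'rV[int]_n)
  (hB1 : is_AI_crystal Bt deg) (hB2 : is_gl_crystal E F eps phi wt) :
  is_AI_crystal (tens_Bt Bt deg E F phi) (tens_deg deg eps phi).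
Proof. exact: (tens_AI_crystal hB2 hB1). Qed.
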